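(* There is an absolute constant $C>0$ such that for every $n\ge2$ and every nonsingular $A\in\mathbb{R}^{n\times n}$, if $U,V$ are independent Haar distributed $n\times n$ orthogonal matrices and $\bar A=UAV$ (so that $Ax=b$ is solved by Gaussian elimination without pivoting applied to $UAVx'=Ub$, outputting $x = Vx'$), then the $\ell_2$ growth factors of $\bar A$ satisfy $$\mathbb{E}\big[\log\big(\max(\rho_U(\bar A),\rho_L(\bar A))\big)\big]\ \le\ C\log(n).$$
   Context: For an $n\times n$ matrix $\bar A$ and $1\le p\le n-1$, partition $\bar A=\begin{pmatrix}\bar A_{11}&\bar A_{12}\\\bar A_{21}&\bar A_{22}\end{pmatrix}$ with $\bar A_{11}$ of size $p\times p$, and let $\mathscr{S}_p(\bar A)=\bar A_{22}-\bar A_{21}\bar A_{11}^{-1}\bar A_{12}$ be the Schur complement of the leading $p\times p$ block. The $\ell_2$ growth factors are $$\rho_U(\bar A):=\max_p\|\mathscr{S}_p(\bar A)\|_2/\|\bar A\|_2,\qquad \rho_L(\bar A):=\max_p\|\bar A_{21}\bar A_{11}^{-1}\|_2 ,$$ where $\|\cdot\|_2$ is the spectral norm and the blocks in $\rho_L$ depend on $p$. Almost surely all leading blocks $\bar A_{11}$ are invertible. *)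

(* Defs.v *)
From HB Require Import structures.
From mathcomp Require Import all_boot all_order all_algebra.
From mathcomp Require Import all_classical all_reals all_analysis.

Set Implicit Arguments.
Unset Strict Implicit.
Unset Printing Implicit Defensive.

Import Order.TTheory GRing.Theory Num.Theory.
Import numFieldNormedType.Exports.

Local Open Scope classical_set_scope.
Local Open Scope ring_scope.

Definition l2norm (R : realType) n (x : 'cV[R]_n) : R :=
  Num.sqrt (\sum_i x i 0 ^+ 2).

Definition spectral_norm (R : realType) m n (A : 'M[R]_(m, n)) : R :=
  sup [set l2norm (A *m x) | x in [set x : 'cV[R]_n | l2norm x <= 1]].

(* A with its type changed so that ulsubmx, ursubmx, dlsubmx and drsubmx are
   the four blocks determined by the leading p x p block. *)
Definition lead_split (R : realType) n (p : 'I_n) (A : 'M[R]_n) :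
    'M[R]_(p + (n - p)) :=
  let e := esym (subnKC (ltnW (ltn_ord p))) in castmx (e, e) A.

(* invmx returns its argument when the leading block is singular; for a random
   matrix U A V as considered here this happens with probability 0. *)
Definition schur_compl (R : realType) n (p : 'I_n) (A : 'M[R]_n) :
    'M[R]_(n - p) :=
  let B := lead_split p A in
  drsubmx B - dlsubmx B *m invmx (ulsubmx B) *m ursubmx B.

(* In both growth factors p ranges over 1 <= p <= n - 1; all the terms are
   nonnegative, so starting from 0 does not change the maximum when n >= 2. *)
Definition rho_U (R : realType) n (A : 'M[R]_n) : R :=
  \big[Num.max/0]_(p < n | (0 < p)%N)
    (spectral_norm (schur_compl p A) / spectral_norm A).

Definition rho_L (R : realType) n (A : 'M[R]_n) : R :=
  \big[Num.max/0]_(p < n | (0 < p)%N)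
    spectral_norm (dlsubmx (lead_split p A)
                   *m invmx (ulsubmx (lead_split p A))).

Notation borel_mx R n := (g_sigma_algebraType (@open 'M[R]_n)).

Definition orthogonal_mx (R : realType) n : set 'M[R]_n :=
  [set Q | Q *m Q^T = 1%:M].

(* Haar probability measure of the compact group O(n), seen as a measure on
   all n x n matrices that is carried by O(n). *)
Definition is_haar_orthogonal (R : realType) n
    (mu : probability (borel_mx R n) R) : Prop :=
  mu (@orthogonal_mx R n) = 1%E /\
  forall (Q : 'M[R]_n) (B : set (borel_mx R n)),
    orthogonal_mx Q -> measurable B ->
    mu [set X : 'M[R]_n | B (Q *m X)] = mu B /\
    mu [set X : 'M[R]_n | B (X *m Q)] = mu B.

Definition independent_rv d (T : measurableType d) (R : realType)
    (P : probability T R) d1 (T1 : measurableType d1) d2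
    (T2 : measurableType d2) (X : T -> T1) (Y : T -> T2) : Prop :=
  forall (A : set T1) (B : set T2), measurable A -> measurable B ->
    P (X @^-1` A `&` Y @^-1` B) = (P (X @^-1` A) * P (Y @^-1` B))%E.

(* Main.v *)
Require Import Defs.
From HB Require Import structures.
From mathcomp Require Import all_boot all_order all_algebra.
From mathcomp Require Import all_classical all_reals all_analysis.
From mathcomp Require Import measurable_realfun ring lra.

Set Implicit Arguments.
Unset Strict Implicit.
Unset Printing Implicit Defensive.

Import Order.TTheory GRing.Theory Num.Theory.
Import numFieldNormedType.Exports.

Local Open Scope classical_set_scope.
Local Open Scope ring_scope.

(** Why the bound holds.  Fix 0 < p < n and write the leading blocks of
    Abar = U A V as A11, A21.  By Cramer's rule each entry of A21 A11^-1 is a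
    quotient b / a of two p x p minors of the first p columns of Abar, which
    share all their rows but one: a uses row i of the leading block where b
    uses row p + q.  Rotating rows i and p + q of U by an orthogonal matrix
    rotates the pair (a, b) in the plane ([minor_rot], [minor_subst_row_rot]) and,
    since U is Haar distributed and independent of V, preserves the joint law
    of (U, V) ([pair_law_mull_invariant]).  So b / a is the slope of a vector of
    uniformly distributed direction, a standard Cauchy variable, whatever p
    and the nonsingular matrix A are.

    No integration over the angle is needed to exploit this.  Rotate by the N
    directions of slopes j / N, j < N: the N events obtained from
    4 N |a| < |b| are pairwise disjoint ([rotated_cones_disjoint],
    [slope_dir_sep]) and have equal probability, so each has probability at
    most 1 / N ([minor_ratio_tail]).  Letting N grow, almost surely a = 0
    forces b = 0, and induction on p then shows that no leading minor vanishes
    ([ae_lead_minor]).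

    Both growth factors are at most polynomial in n and the largest of the at
    most n^3 quotients |b / a| ([growth_factors_le]); for rho_U this uses
    S_p(Abar) = A22 - (A21 A11^-1) A12.  Hence, up to powers of n, the maximum
    of the growth factors has a tail of order 1 / t, and its logarithm exceeds
    9 log n by k log 2 with probability at most 2^-k.  Summing over k gives
    the expectation ([integrable_log_tail]).  The tail bound with a and b
    exchanged controls the negative part of the logarithm, hence
    integrability. *)

(** * Spectral norms and a deterministic bound on the growth factors *)

Lemma l2norm_ge0 (R : realType) n (x : 'cV[R]_n) : 0 <= l2norm x.
Proof. exact: sqrtr_ge0. Qed.

Lemma sqr_l2norm (R : realType) n (x : 'cV[R]_n) :
  l2norm x ^+ 2 = \sum_i x i 0 ^+ 2.
Proof. by rewrite sqr_sqrtr // sumr_ge0 // => i _; exact: sqr_ge0. Qed.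

Lemma ler_l2norm (R : realType) n (x : 'cV[R]_n) (c : R) :
  0 <= c -> (l2norm x <= c) = (\sum_i x i 0 ^+ 2 <= c ^+ 2).
Proof.
by move=> c0; rewrite -sqr_l2norm ler_pXn2r // nnegrE l2norm_ge0.
Qed.

Lemma l2norm0 (R : realType) n : l2norm (0 : 'cV[R]_n) = 0.
Proof. by rewrite /l2norm big1 ?sqrtr0 // => i _; rewrite mxE expr0n. Qed.

Lemma l2normZ (R : realType) n (a : R) (x : 'cV[R]_n) :
  0 <= a -> l2norm (a *: x) = a * l2norm x.
Proof.
move=> a0; rewrite /l2norm -{2}(ger0_norm a0) -sqrtr_sqr -sqrtrM ?sqr_ge0 // mulr_sumr.
by congr (Num.sqrt _); apply: eq_bigr => i _; rewrite mxE exprMn.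
Qed.

Lemma l2norm_col_mx (R : realType) m n (x : 'cV[R]_m) (y : 'cV[R]_n) :
  l2norm (col_mx x y) ^+ 2 = l2norm x ^+ 2 + l2norm y ^+ 2.
Proof.
rewrite !sqr_l2norm big_split_ord /=; congr (_ + _); apply: eq_bigr => i _.
  by rewrite col_mxEu.
by rewrite col_mxEd.
Qed.

Lemma ler_entry_l2norm (R : realType) n (x : 'cV[R]_n) i : `|x i 0| <= l2norm x.
Proof.
rewrite -(@ler_pXn2r _ 2) ?nnegrE ?l2norm_ge0 // real_normK ?num_real //.
rewrite sqr_l2norm (bigD1 i) //= lerDl sumr_ge0 // => j _; exact: sqr_ge0.
Qed.

(** Each coordinate of [A *m x] is at most [n * z * l2norm x].  The dimensional
    factor is far from optimal; any power of the dimension turns into a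
    constant multiple of log n. *)
Lemma l2norm_mulmx_le (R : realType) m n (A : 'M[R]_(m, n)) (x : 'cV[R]_n) (z : R) :
  0 <= z -> (forall i j, `|A i j| <= z) ->
  l2norm (A *m x) <= m%:R * n%:R * z * l2norm x.
Proof.
move=> z0 Az; have x0 := l2norm_ge0 x.
rewrite ler_l2norm ?mulr_ge0 //.
have entry i : `|(A *m x) i 0| <= n%:R * z * l2norm x.
  rewrite mxE (le_trans (ler_norm_sum _ _ _)) //.
  rewrite (@le_trans _ _ (\sum_(j < n) z * l2norm x)) //.
    apply: ler_sum => j _; rewrite normrM ler_pM //; exact: ler_entry_l2norm.
  by rewrite sumr_const card_ord -mulrA mulr_natl.
rewrite (@le_trans _ _ (\sum_(i < m) (n%:R * z * l2norm x) ^+ 2)) //.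
  apply: ler_sum => i _; rewrite -[leLHS]real_normK ?num_real //.
  by rewrite ler_pXn2r // nnegrE !mulr_ge0.
rewrite sumr_const card_ord -[leLHS]mulr_natl.
have -> : m%:R * n%:R * z * l2norm x = m%:R * (n%:R * z * l2norm x) by ring.
rewrite [leRHS]exprMn.
rewrite ler_wpM2r ?sqr_ge0 // -natrX ler_nat.
by case: (m) => // k; rewrite expnS leq_pmulr // expn_gt0.
Qed.

Lemma mx_entries_bounded (R : realType) m n (A : 'M[R]_(m, n)) :
  {z : R | 0 <= z & forall i j, `|A i j| <= z}.
Proof.
exists (\sum_i \sum_j `|A i j|); first by rewrite sumr_ge0 // => i _; rewrite sumr_ge0.
move=> i j; rewrite (bigD1 i) //= (bigD1 j) //= -addrA lerDl addr_ge0 ?sumr_ge0 //.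
by move=> k _; rewrite sumr_ge0.
Qed.

Lemma has_sup_spectral_norm (R : realType) m n (A : 'M[R]_(m, n)) :
  has_sup [set l2norm (A *m x) | x in [set x : 'cV[R]_n | l2norm x <= 1]].
Proof.
split; first by exists (l2norm (A *m 0)), 0 => //=; rewrite l2norm0.
have [z z0 Az] := mx_entries_bounded A; exists (m%:R * n%:R * z) => _ [x /= x1 <-].
apply: le_trans (l2norm_mulmx_le _ z0 Az) _.
by rewrite -[leRHS]mulr1 ler_wpM2l ?mulr_ge0.
Qed.

Lemma spectral_norm_ge (R : realType) m n (A : 'M[R]_(m, n)) (x : 'cV[R]_n) :
  l2norm x <= 1 -> l2norm (A *m x) <= spectral_norm A.
Proof.
by move=> x1; apply: sup_upper_bound (has_sup_spectral_norm A) _ _; exists x.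
Qed.

Lemma spectral_norm_le (R : realType) m n (A : 'M[R]_(m, n)) (c : R) :
  (forall x, l2norm x <= 1 -> l2norm (A *m x) <= c) -> spectral_norm A <= c.
Proof.
move=> h; apply: ge_sup; first by case: (has_sup_spectral_norm A).
by move=> _ [x /= x1 <-]; exact: h.
Qed.

Lemma spectral_norm_ge0 (R : realType) m n (A : 'M[R]_(m, n)) : 0 <= spectral_norm A.
Proof.
apply: le_trans (l2norm_ge0 (A *m 0)) (spectral_norm_ge _ _).
by rewrite l2norm0.
Qed.

Lemma entry_le_spectral_norm (R : realType) m n (A : 'M[R]_(m, n)) i j :
  `|A i j| <= spectral_norm A.
Proof.
have d1 : l2norm (delta_mx j 0 : 'cV[R]_n) <= 1.
  rewrite ler_l2norm // (bigD1 j) //= big1 ?mxE ?eqxx ?addr0 // => k /negbTE kj.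
  by rewrite mxE kj expr0n.
apply: le_trans (spectral_norm_ge A d1).
by apply: le_trans (ler_entry_l2norm _ i); rewrite -colE mxE.
Qed.

Lemma spectral_norm_castmx (R : realType) m n m' n' (e : (m = m') * (n = n'))
    (A : 'M[R]_(m, n)) : spectral_norm (castmx e A) = spectral_norm A.
Proof. by case: e => e1 e2; case: _ / e1; case: _ / e2; rewrite castmx_id. Qed.

Lemma spectral_norm_lead_split (R : realType) n (p : 'I_n) (A : 'M[R]_n) :
  spectral_norm (lead_split p A) = spectral_norm A.
Proof. exact: spectral_norm_castmx. Qed.

(** Applied to the vector (0, x), [A] returns both right blocks at once. *)
Lemma spectral_norm_right_blocks (R : realType) m1 m2 n1 n2
    (A : 'M[R]_(m1 + m2, n1 + n2)) (x : 'cV[R]_n2) :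
  l2norm x <= 1 ->
  l2norm (ursubmx A *m x) <= spectral_norm A /\ l2norm (drsubmx A *m x) <= spectral_norm A.
Proof.
move=> x1.
have y1 : l2norm (col_mx (0 : 'cV[R]_n1) x) <= 1.
  rewrite -(@ler_pXn2r _ 2) ?nnegrE ?l2norm_ge0 // l2norm_col_mx l2norm0 expr0n add0r.
  by rewrite ler_pXn2r ?nnegrE ?l2norm_ge0.
have := spectral_norm_ge A y1.
rewrite -{1}(submxK A) mul_block_col !mulmx0 !add0r => h.
have A0 := spectral_norm_ge0 A.
have : l2norm (ursubmx A *m x) ^+ 2 + l2norm (drsubmx A *m x) ^+ 2 <= spectral_norm A ^+ 2.
  by rewrite -l2norm_col_mx ler_pXn2r // nnegrE l2norm_ge0.
move=> h2; split; rewrite -(@ler_pXn2r _ 2) ?nnegrE ?l2norm_ge0 //;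
  apply: le_trans h2; by rewrite ?lerDl ?lerDr sqr_ge0.
Qed.

Lemma l2normB_sqr_le (R : realType) n (x y : 'cV[R]_n) :
  l2norm (x - y) ^+ 2 <= 2 * l2norm x ^+ 2 + 2 * l2norm y ^+ 2.
Proof.
rewrite !sqr_l2norm !mulr_sumr -big_split /=; apply: ler_sum => i _.
rewrite !mxE -subr_ge0.
have -> : 2 * x i 0 ^+ 2 + 2 * y i 0 ^+ 2 - (x i 0 - y i 0) ^+ 2 = (x i 0 + y i 0) ^+ 2 by ring.
exact: sqr_ge0.
Qed.

(** A22 and A12 have norm at most that of A, so in A22 - (A21 A11^-1) A12 only
    the middle factor, whose operator norm is bounded by c, can be large. *)
Lemma spectral_norm_schur_le (R : realType) n (p : 'I_n) (A : 'M[R]_n) (c : R) :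
  0 <= c ->
  (forall y, l2norm (dlsubmx (lead_split p A) *m invmx (ulsubmx (lead_split p A)) *m y)
     <= c * l2norm y) ->
  spectral_norm (schur_compl p A) <= 2 * (1 + c) * spectral_norm A.
Proof.
move=> c0 Lc; apply: spectral_norm_le => x x1.
rewrite /schur_compl mulmxBl -[X in _ - X]mulmxA -(spectral_norm_lead_split p A).
have [ur dr] := spectral_norm_right_blocks (lead_split p A) x1.
set B := lead_split p A in ur dr Lc *.
have B0 := spectral_norm_ge0 B.
have Lu := le_trans (Lc (ursubmx B *m x)) (ler_wpM2l c0 ur).
rewrite -(@ler_pXn2r _ 2) ?nnegrE ?l2norm_ge0 ?mulr_ge0 ?addr_ge0 //.
apply: le_trans (l2normB_sqr_le _ _) _.
apply: (@le_trans _ _ (2 * spectral_norm B ^+ 2 + 2 * (c * spectral_norm B) ^+ 2)).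
  by rewrite lerD // ler_wpM2l // ler_pXn2r // nnegrE ?l2norm_ge0 ?mulr_ge0.
rewrite -subr_ge0.
have -> : (2 * (1 + c) * spectral_norm B) ^+ 2
    - (2 * spectral_norm B ^+ 2 + 2 * (c * spectral_norm B) ^+ 2)
  = (2 + 8 * c + 2 * c ^+ 2) * spectral_norm B ^+ 2 by ring.
by rewrite mulr_ge0 ?sqr_ge0 // !addr_ge0 ?mulr_ge0 ?sqr_ge0.
Qed.

(** rho_L is a norm of A21 A11^-1, and rho_U is controlled by the same matrix
    through the Schur complement, so a bound on its entries is all that has to
    be established. *)
Lemma growth_factors_le (R : realType) n (A : 'M[R]_n) (z : R) :
  0 <= z ->
  (forall p : 'I_n, (0 < p)%N -> forall i j,
    `|(dlsubmx (lead_split p A) *m invmx (ulsubmx (lead_split p A))) i j| <= z) ->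
  Num.max (rho_U A) (rho_L A) <= 2 * (1 + n%:R ^+ 2 * z).
Proof.
move=> z0 hz.
have Lc (p : 'I_n) : (0 < p)%N -> forall y,
    l2norm (dlsubmx (lead_split p A) *m invmx (ulsubmx (lead_split p A)) *m y)
     <= n%:R ^+ 2 * z * l2norm y.
  move=> p0 y; apply: le_trans (l2norm_mulmx_le _ z0 (hz p p0)) _.
  rewrite ler_wpM2r ?l2norm_ge0 // ler_wpM2r // expr2 ler_pM ?ler_nat ?leq_subr //.
  exact: ltnW.
have nz : 0 <= n%:R ^+ 2 * z by rewrite mulr_ge0 ?sqr_ge0.
have bnd0 : 0 <= 2 * (1 + n%:R ^+ 2 * z) by rewrite mulr_ge0 // addr_ge0.
rewrite ge_max; apply/andP; split; apply/bigmax_leP; split=> // p p0.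
  have := spectral_norm_schur_le nz (Lc p p0).
  have := spectral_norm_ge0 A; rewrite le_eqVlt => /orP[/eqP <- _|A0].
    by rewrite invr0 mulr0.
  by rewrite ler_pdivrMr.
apply: spectral_norm_le => x x1; apply: le_trans (Lc p p0 x) _.
apply: (@le_trans _ _ (n%:R ^+ 2 * z)); first by rewrite -[leRHS]mulr1 ler_wpM2l.
by rewrite mulrDr mulr1; lra.
Qed.

(** Used with a single entry, to keep the growth factors away from 0. *)
Lemma growth_factors_ge (R : realType) n (A : 'M[R]_n) (p : 'I_n) i j :
  (0 < p)%N ->
  `|(dlsubmx (lead_split p A) *m invmx (ulsubmx (lead_split p A))) i j|
    <= Num.max (rho_U A) (rho_L A).
Proof.
move=> p0; apply: le_trans (entry_le_spectral_norm _ i j) _.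
by rewrite le_max; apply/orP; right; apply: (le_bigmax_cond _ _ p0).
Qed.

(** * Minors under rotations of two rows *)

(** f and g need not be increasing: substituting another row for a selected one
    destroys the order of the rows. *)
Definition minor (R : comNzRingType) n p (f g : 'I_p -> 'I_n) (M : 'M[R]_n) : R :=
  \det (mxsub f g M).

Definition subst_row p n (f : 'I_p -> 'I_n) (i : 'I_p) (k : 'I_n) (j : 'I_p) : 'I_n :=
  if j == i then k else f j.

Definition rot_mx (R : nzRingType) n (i k : 'I_n) (c s : R) : 'M[R]_n :=
  \matrix_(a, b)
    if a == i then c *+ (b == i) + s *+ (b == k)
    else if a == k then c *+ (b == k) - s *+ (b == i)
    else (a == b)%:R.

Lemma rot_mxE (R : nzRingType) n m (i k : 'I_n) (c s : R) (M : 'M[R]_(n, m)) a b :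
  (rot_mx i k c s *m M) a b =
  if a == i then c * M i b + s * M k b
  else if a == k then c * M k b - s * M i b else M a b.
Proof.
have sumdelta (x : R) j : \sum_l (x *+ (l == j)) * M l b = x * M j b.
  by rewrite (bigD1 j) //= eqxx big1 ?addr0 // => l /negbTE ->; rewrite mul0r.
rewrite mxE; under eq_bigr do rewrite mxE.
case: (a == i).
  by under eq_bigr do rewrite mulrDl; rewrite big_split /= !sumdelta.
case: (a == k).
  by under eq_bigr do rewrite mulrBl; rewrite sumrB /= !sumdelta.
by under eq_bigr do rewrite eq_sym; rewrite sumdelta mul1r.
Qed.

Lemma rot_mx_orthogonal (R : realType) n (i k : 'I_n) (c s : R) :
  i != k -> c ^+ 2 + s ^+ 2 = 1 -> orthogonal_mx (rot_mx i k c s).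
Proof.
move=> ik cs; rewrite /orthogonal_mx /=.
apply/matrixP => a b; rewrite rot_mxE !mxE.
have ik' := negbTE ik; have ki : (k == i) = false by rewrite eq_sym.
move: cs; rewrite !expr2 => cs; rewrite !eqxx ki ik'.
case: (eqVneq a i) => ai; [|case: (eqVneq a k) => ak];
case: (eqVneq b i) => bi; try case: (eqVneq b k) => bk;
rewrite ?ai ?ak ?bi ?bk ?eqxx ?ik' ?ki ?(negbTE ai) ?(negbTE ak) ?(negbTE bi) ?(negbTE bk) /=.
all: rewrite ?mulr0n ?mulr1n ?(eq_sym i) ?(eq_sym k) ?(negbTE bi) ?(negbTE bk).
all: first [ring | lra | by rewrite eq_sym | by rewrite !mulr0 ?addr0 ?subr0].
Qed.

(** Only row i0 of the selected submatrix is affected by the rotation, and it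
    becomes a combination of two rows, so multilinearity of the determinant
    applies.  Together with the next lemma: the two minors form a vector that
    is rotated by the same angle as the rows. *)
Lemma minor_rot (R : comNzRingType) n p (f g : 'I_p -> 'I_n) (i0 : 'I_p) (k : 'I_n)
    (c s : R) (M : 'M[R]_n) :
  injective f -> (forall j, f j != k) ->
  minor f g (rot_mx (f i0) k c s *m M)
    = c * minor f g M + s * minor (subst_row f i0 k) g M.
Proof.
move=> finj fk; apply: (determinant_multilinear (i0 := i0)).
- by apply/rowP => b; rewrite [LHS]mxE mxE rot_mxE eqxx !mxE /subst_row eqxx.
- apply/matrixP => a b; rewrite [RHS]mxE [in RHS]mxE rot_mxE !mxE.
  by rewrite (inj_eq finj) eq_sym (negbTE (neq_lift _ _)) (negbTE (fk _)).
- apply/matrixP => a b; rewrite [RHS]mxE [in RHS]mxE rot_mxE !mxE.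
  rewrite (inj_eq finj) (negbTE (fk _)).
  by rewrite /subst_row eq_sym (negbTE (neq_lift _ _)).
Qed.

Lemma minor_subst_row_rot (R : comNzRingType) n p (f g : 'I_p -> 'I_n) (i0 : 'I_p) (k : 'I_n)
    (c s : R) (M : 'M[R]_n) :
  injective f -> (forall j, f j != k) ->
  minor (subst_row f i0 k) g (rot_mx (f i0) k c s *m M)
    = c * minor (subst_row f i0 k) g M - s * minor f g M.
Proof.
move=> finj fk; rewrite -mulNr; apply: (determinant_multilinear (i0 := i0)).
- apply/rowP => b; rewrite [LHS]mxE mxE rot_mxE /subst_row eqxx.
  by rewrite !mxE eqxx (eq_sym k) (negbTE (fk _)) eqxx mulNr.
- apply/matrixP => a b; rewrite [RHS]mxE [in RHS]mxE rot_mxE !mxE /subst_row.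
  rewrite eq_sym (negbTE (neq_lift _ _)) (inj_eq finj) (negbTE (fk _)).
  by rewrite eq_sym (negbTE (neq_lift _ _)).
- apply/matrixP => a b; rewrite [RHS]mxE [in RHS]mxE rot_mxE !mxE /subst_row.
  rewrite [lift _ _ == _]eq_sym (negbTE (neq_lift _ _)) (inj_eq finj) (negbTE (fk _)).
  by rewrite [lift _ _ == _]eq_sym (negbTE (neq_lift _ _)).
Qed.

(** In both hypotheses the vector (a, b) is almost orthogonal to the direction
    (c, s): its component a' along it satisfies t^2 a'^2 < a^2 + b^2.  A plane
    vector cannot be almost orthogonal to two well separated directions; the
    separation is measured by their cross product. *)
Lemma rotated_cones_disjoint (R : realFieldType) (a b c1 s1 c2 s2 t : R) :
  0 < t -> c1 ^+ 2 + s1 ^+ 2 = 1 -> c2 ^+ 2 + s2 ^+ 2 = 1 ->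
  2 <= t * `|c1 * s2 - s1 * c2| ->
  t * `|c1 * a + s1 * b| < `|c1 * b - s1 * a| ->
  t * `|c2 * a + s2 * b| < `|c2 * b - s2 * a| -> False.
Proof.
move=> t0 cs1 cs2 sep h1 h2.
have key (c s : R) : c ^+ 2 + s ^+ 2 = 1 ->
    t * `|c * a + s * b| < `|c * b - s * a| ->
    t ^+ 2 * (c * a + s * b) ^+ 2 < a ^+ 2 + b ^+ 2.
  move=> cs h; have : (t * `|c * a + s * b|) ^+ 2 < `|c * b - s * a| ^+ 2.
    by rewrite ltr_pXn2r // nnegrE ?mulr_ge0 // ltW.
  rewrite exprMn !real_normK ?num_real // => h'.
  apply: (lt_le_trans h').
  have -> : a ^+ 2 + b ^+ 2 = (c * a + s * b) ^+ 2 + (c * b - s * a) ^+ 2.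
    transitivity ((c ^+ 2 + s ^+ 2) * (a ^+ 2 + b ^+ 2)); last by ring.
    by rewrite cs mul1r.
  by rewrite lerDr sqr_ge0.
have k1 := key _ _ cs1 h1; have k2 := key _ _ cs2 h2.
have sep2 : 4 <= t ^+ 2 * (c1 * s2 - s1 * c2) ^+ 2.
  have : 2 ^+ 2 <= (t * `|c1 * s2 - s1 * c2|) ^+ 2.
    by rewrite ler_pXn2r // nnegrE ?mulr_ge0 // ltW.
  by rewrite exprMn real_normK ?num_real //; apply: le_trans; rewrite -natrX.
set a1 := c1 * a + s1 * b in k1; set a2 := c2 * a + s2 * b in k2.
set D := c1 * s2 - s1 * c2 in sep2.
(* The vector (a, b) is recovered from its components along the two directions. *)
have D1 : D * a = s2 * a1 - s1 * a2 by rewrite /D /a1 /a2; ring.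
have D2 : D * b = c1 * a2 - c2 * a1 by rewrite /D /a1 /a2; ring.
have e : D ^+ 2 * (a ^+ 2 + b ^+ 2) <= 2 * (a1 ^+ 2 + a2 ^+ 2).
  rewrite mulrDr -!exprMn D1 D2 -subr_ge0.
  have -> : 2 * (a1 ^+ 2 + a2 ^+ 2) - ((s2 * a1 - s1 * a2) ^+ 2 + (c1 * a2 - c2 * a1) ^+ 2)
    = (s2 * a1 + s1 * a2) ^+ 2 + (c1 * a2 + c2 * a1) ^+ 2
      + 2 * a1 ^+ 2 * (1 - (c2 ^+ 2 + s2 ^+ 2)) + 2 * a2 ^+ 2 * (1 - (c1 ^+ 2 + s1 ^+ 2)).
    ring.
  by rewrite cs1 cs2 subrr !mulr0 !addr0 addr_ge0 ?sqr_ge0.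
have r0 : 0 <= a ^+ 2 + b ^+ 2 by rewrite addr_ge0 ?sqr_ge0.
have := ler_wpM2r r0 sep2; rewrite -mulrA => e1.
have e2 := ler_wpM2l (sqr_ge0 t) e.
lra.
Qed.

(** Cramer's rule for the linear system with row vector unknown whose right-hand
    side is row k of D. *)
Lemma mul_invmx_cramer (R : comUnitRingType) p q (D : 'M[R]_(q, p)) (B : 'M[R]_p) k i :
  B \in unitmx ->
  (D *m invmx B) k i = \det (\matrix_(a, b) if a == i then D k b else B a b) / \det B.
Proof.
move=> Bu; rewrite /invmx Bu -scalemxAr mxE mulrC; congr (_ * _).
rewrite (expand_det_row _ i) mxE; apply: eq_bigr => j _; rewrite !mxE eqxx.
congr (_ * _); rewrite /cofactor; congr (_ * \det _).
by apply/matrixP => a b; rewrite !mxE eq_sym (negbTE (neq_lift _ _)).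
Qed.

(** The cofactors of the last row do not depend on that row.  If all the minors
    in the conclusion vanished, the vector of these cofactors, placed in the
    columns g, would be in the kernel of M, while its last coordinate is the
    assumed nonzero minor. *)
Lemma minor_extend (R : fieldType) n p (M : 'M[R]_n.+1) (f g : 'I_p.+1 -> 'I_n.+1) :
  M \in unitmx -> injective g ->
  minor (f \o lift ord_max) (g \o lift ord_max) M != 0 ->
  exists k, minor (subst_row f ord_max k) g M != 0.
Proof.
move=> Mu ginj m0; apply/existsP; apply/contraT; rewrite negb_exists => /forallP h.
pose c j := cofactor (mxsub f g M) ord_max j.
pose v : 'cV[R]_n.+1 := \col_l \sum_(j | g j == l) c j.
have Mv : M *m v = 0.
  apply/colP => k; transitivity (minor (subst_row f ord_max k) g M); last first.
    by rewrite mxE; apply/eqP/negbNE.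
  rewrite mxE /minor (expand_det_row _ ord_max) [RHS](partition_big g xpredT) //=.
  apply: eq_bigr => l _; rewrite mxE big_distrr /=; apply: eq_bigr => j /eqP gj.
  rewrite !mxE /subst_row eqxx gj; congr (_ * _); rewrite /c /cofactor; congr (_ * \det _).
  by apply/matrixP => a b; rewrite !mxE eq_sym (negbTE (neq_lift _ _)).
have v0 : v = 0 by rewrite -(mulKmx Mu v) Mv mulmx0.
move/colP: v0 => /(_ (g ord_max)); rewrite !mxE.
rewrite (big_pred1 ord_max) => [|j]; last by rewrite (inj_eq ginj).
move/eqP; rewrite /c /cofactor mulf_eq0 signr_eq0 /= => /eqP d0.
suff e : minor (f \o lift ord_max) (g \o lift ord_max) M = 0 by rewrite e eqxx in m0.
rewrite -d0; congr (\det _); apply/matrixP => a b; by rewrite !mxE.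
Qed.

(** * Measurability of random matrices and of the growth factors *)

Lemma measurable_set_ltr d (T : measurableType d) (R : realType) (f g : T -> R) :
  measurable_fun setT f -> measurable_fun setT g -> measurable [set w | f w < g w].
Proof.
move=> mf mg.
have := measurable_fun_ltr mf mg measurableT (I : measurable [set true]).
by rewrite setTI.
Qed.

Lemma measurable_set_ler d (T : measurableType d) (R : realType) (f g : T -> R) :
  measurable_fun setT f -> measurable_fun setT g -> measurable [set w | f w <= g w].
Proof.
by move=> mf mg; have := measurable_fun_le measurableT mf mg; rewrite setTI.
Qed.

Lemma measurable_set_neq0 d (T : measurableType d) (R : realType) (f : T -> R) :
  measurable_fun setT f -> measurable [set w | f w != 0].
Proof.
move=> mf; rewrite (_ : mkset _ = [set w | 0 < `|f w|]); last first.
  by apply/seteqP; split => w /=; rewrite normr_gt0.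
by apply: measurable_set_ltr => //; exact: measurableT_comp.
Qed.

Lemma measurable_fun_from_rays d (T : measurableType d) (R : realType) (f : T -> R) :
  (forall c, measurable [set w | f w <= c]) -> measurable_fun setT f.
Proof.
move=> fc; apply: (measurability _ (RGenOInfty.measurableE R)) => _ [_ [c ->] <-].
rewrite setTI (_ : _ @^-1` _ = ~` [set w | f w <= c]); first exact: measurableC.
by apply/seteqP; split => w /=; rewrite in_itv /= andbT ltNge => /negP.
Qed.

(** Continuity fails only at 0, a measurable singleton. *)
Lemma measurable_fun_invr (R : realType) : measurable_fun setT (@GRing.inv R).
Proof.
have -> : [set: R] = [set 0] `|` [set x | x != 0].
  by apply/seteqP; split => // x _ /=; case: (eqVneq x 0) => ?; [left|right].
apply/measurable_funU => //; first exact: measurable_set_neq0.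
split; first exact: measurable_fun_set1.
apply: open_continuous_measurable_fun; first exact: open_neq.
by move=> x; rewrite inE => /= x0; exact: inv_continuous.
Qed.

Lemma cvg_sumr (R : realType) (X : Type) (F : set_system X) {FF : Filter F}
    (I : finType) (u : I -> X -> R) (l : I -> R) :
  (forall i, u i @ F --> l i) -> (fun x => \sum_i u i x) @ F --> \sum_i l i.
Proof. by move=> ul; apply: cvg_big => //; exact: add_continuous. Qed.

(** Measurability entry by entry suits matrices of all sizes and blocks, and is
    preserved by every polynomial operation without comparing the Borel
    sigma-algebra of a matrix space with a product sigma-algebra. *)
Definition measurable_entries d (T : measurableType d) (R : realType) m n
  (M : T -> 'M[R]_(m, n)) := forall i j, measurable_fun setT (fun w => M w i j).

Section measurable_entries_theory.
Context d (T : measurableType d) (R : realType).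

Lemma measurable_entries_cst m n (A : 'M[R]_(m, n)) :
  measurable_entries (fun _ : T => A).
Proof. by move=> i j; exact: measurable_cst. Qed.

Lemma measurable_entries_mulmx m n p (M : T -> 'M[R]_(m, n)) (N : T -> 'M[R]_(n, p)) :
  measurable_entries M -> measurable_entries N -> measurable_entries (fun w => M w *m N w).
Proof.
move=> mM mN i j; under eq_fun do rewrite mxE.
by apply: measurable_sum => k; exact: measurable_funM.
Qed.

Lemma measurable_entriesB m n (M N : T -> 'M[R]_(m, n)) :
  measurable_entries M -> measurable_entries N -> measurable_entries (fun w => M w - N w).
Proof.
by move=> mM mN i j; under eq_fun do rewrite !mxE; exact: measurable_funB.
Qed.

Lemma measurable_entries_mxsub m n m' n' (f : 'I_m' -> 'I_m) (g : 'I_n' -> 'I_n)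
    (M : T -> 'M[R]_(m, n)) :
  measurable_entries M -> measurable_entries (fun w => mxsub f g (M w)).
Proof. by move=> mM i j; under eq_fun do rewrite mxE; exact: mM. Qed.

Lemma measurable_fun_det n (M : T -> 'M[R]_n) :
  measurable_entries M -> measurable_fun setT (fun w => \det (M w)).
Proof.
move=> mM; apply: measurable_sum => s; apply: measurable_funM => //.
by apply: measurable_prod => i _; exact: mM.
Qed.

Lemma measurable_entries_invmx n (M : T -> 'M[R]_n) :
  measurable_entries M -> measurable_entries (fun w => invmx (M w)).
Proof.
move=> mM i j.
rewrite (_ : (fun _ => _) =
  (fun w => if \det (M w) != 0 then (\det (M w))^-1 * \adj (M w) i j else M w i j)).
  have mdet := measurable_fun_det mM.
  apply: measurable_fun_ifT => //.
    apply: (measurable_fun_bool true) => /=.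
    by rewrite setTI; exact: measurable_set_neq0.
  apply: measurable_funM; first exact: (measurableT_comp (@measurable_fun_invr R)).
  under eq_fun do rewrite mxE; apply: measurable_funM => //.
  apply: measurable_fun_det => a b.
  by under eq_fun do rewrite !mxE; exact: mM.
apply/funext => w; rewrite /invmx unitmxE unitfE.
by case: ifP => // _; rewrite mxE.
Qed.

(** The spectral norm is a supremum over an uncountable ball.  In the homogeneous
    form |A q|^2 <= c^2 |q|^2, without constraint on q, both sides are
    polynomials in q, so it is enough to test rational vectors; this makes
    the sublevel sets of the norm countable intersections. *)
Lemma spectral_norm_leP_rat m n (A : 'M[R]_(m, n)) (c : R) : 0 <= c ->
  spectral_norm A <= c <->
  forall q : 'cV[rat]_n,
    \sum_i (\sum_j A i j * ratr (q j 0)) ^+ 2 <= c ^+ 2 * \sum_j ratr (q j 0) ^+ 2.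
Proof.
move=> c0; split => [Ac q|h].
  pose x : 'cV[R]_n := \col_j ratr (q j 0).
  have -> : \sum_j (ratr (q j 0) : R) ^+ 2 = l2norm x ^+ 2.
    by rewrite sqr_l2norm; apply: eq_bigr => j _; rewrite mxE.
  have -> : \sum_i (\sum_j A i j * ratr (q j 0)) ^+ 2 = l2norm (A *m x) ^+ 2.
    rewrite sqr_l2norm; apply: eq_bigr => i _; rewrite mxE; congr (_ ^+ 2).
    by apply: eq_bigr => j _; rewrite mxE.
  rewrite -exprMn ler_pXn2r ?nnegrE ?mulr_ge0 ?l2norm_ge0 //.
  have := l2norm_ge0 x; rewrite le_eqVlt => /orP[/eqP x0|x0].
    suff -> : x = 0 by rewrite mulmx0 !l2norm0 mulr0.
    apply/colP => j; rewrite [RHS]mxE; apply/eqP; rewrite -normr_le0 x0.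
    exact: ler_entry_l2norm.
  rewrite -ler_pdivrMr //; apply: le_trans Ac.
  rewrite mulrC -l2normZ ?invr_ge0 ?l2norm_ge0 // scalemxAr; apply: spectral_norm_ge.
  by rewrite l2normZ ?invr_ge0 ?l2norm_ge0 // mulVf ?gt_eqF.
apply: spectral_norm_le => x x1.
have approx (k : nat) (j : 'I_n) : exists q : rat, x j 0 < ratr q < x j 0 + k.+1%:R^-1.
  have [|q] := @rat_in_itvoo R (x j 0) (x j 0 + k.+1%:R^-1).
    by rewrite ltrDl invr_gt0.
  by rewrite in_itv /=; exists q.
pose q (j : 'I_n) (k : nat) : R := ratr (projT1 (cid (approx k j))).
have qx j : q j @ \oo --> x j 0.
  apply: (squeeze_cvgr (f := fun=> x j 0) (h := fun k => x j 0 + k.+1%:R^-1)).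
  - by near=> k; have /andP[/ltW -> /ltW ->] := projT2 (cid (approx k j)).
  - exact: cvg_cst.
  - rewrite -[X in _ --> X]addr0; apply: cvgD; first exact: cvg_cst.
    exact: cvg_harmonic.
rewrite ler_l2norm //.
have x2 : \sum_j x j 0 ^+ 2 <= 1 by rewrite -[leRHS](expr1n _ 2) -ler_l2norm.
apply: (@le_trans _ _ (c ^+ 2 * \sum_j x j 0 ^+ 2)); last first.
  by rewrite -[leRHS]mulr1 ler_wpM2l ?sqr_ge0.
have c1 : (fun k => \sum_i (\sum_j A i j * q j k) ^+ 2) @ \oo --> \sum_i ((A *m x) i 0) ^+ 2.
  apply: (cvg_sumr (u := fun i k => (\sum_j A i j * q j k) ^+ 2)) => i.
  rewrite mxE; apply: cvgM; apply: (cvg_sumr (u := fun j k => A i j * q j k)) => j;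
    by apply: cvgM; [exact: cvg_cst|exact: qx].
have c2 : (fun k => c ^+ 2 * \sum_j q j k ^+ 2) @ \oo --> c ^+ 2 * \sum_j x j 0 ^+ 2.
  apply: cvgM; first exact: cvg_cst.
  by apply: (cvg_sumr (u := fun j k => q j k ^+ 2)) => j; apply: cvgM; exact: qx.
rewrite -(cvg_lim _ c1) // -(cvg_lim _ c2) //; apply: ler_lim.
- by apply/cvg_ex; eexists; exact: c1.
- by apply/cvg_ex; eexists; exact: c2.
near=> k.
have := h (\col_j projT1 (cid (approx k j))).
under eq_bigr do under eq_bigr do rewrite mxE.
by under [in X in _ * X]eq_bigr do rewrite mxE.
Unshelve. all: by end_near. Qed.

Lemma measurable_fun_spectral_norm m n (M : T -> 'M[R]_(m, n)) :
  measurable_entries M -> measurable_fun setT (fun w => spectral_norm (M w)).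
Proof.
move=> mM; apply: measurable_fun_from_rays => c.
have [c0|c0] := leP 0 c; last first.
  rewrite (_ : mkset _ = set0) //; apply/seteqP; split => // w /= wc.
  by have := le_lt_trans wc c0; rewrite ltNge spectral_norm_ge0.
pose q k : 'cV[rat]_n := odflt 0 (unpickle k).
rewrite (_ : mkset _ = \bigcap_k [set w |
    \sum_i (\sum_j M w i j * ratr (q k j 0)) ^+ 2 <= c ^+ 2 * \sum_j ratr (q k j 0) ^+ 2]).
  apply: bigcap_measurableType => k _; apply: measurable_set_ler => //.
  apply: measurable_sum => i; apply: measurable_funX.
  by apply: measurable_sum => j; exact: measurable_funM.
apply/seteqP; split => [w /= /(spectral_norm_leP_rat _ c0) h k _|w /= h].
  exact: h.
apply/(spectral_norm_leP_rat _ c0) => r.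
by have := h (pickle r) I; rewrite /= /q pickleK.
Qed.

Lemma measurable_entries_lead_split n (p : 'I_n) (M : T -> 'M[R]_n) :
  measurable_entries M -> measurable_entries (fun w => lead_split p (M w)).
Proof. by move=> mM i j; under eq_fun do rewrite castmxE; exact: mM. Qed.

Lemma measurable_entries_blocks m1 m2 n1 n2 (M : T -> 'M[R]_(m1 + m2, n1 + n2)) :
  measurable_entries M ->
  [/\ measurable_entries (fun w => ulsubmx (M w)), measurable_entries (fun w => ursubmx (M w)),
      measurable_entries (fun w => dlsubmx (M w)) & measurable_entries (fun w => drsubmx (M w))].
Proof. by move=> mM; split => i j; under eq_fun do rewrite !mxE; exact: mM. Qed.

Lemma measurable_fun_bigmax (I : finType) (P : pred I) (f : I -> T -> R) :
  (forall i, measurable_fun setT (f i)) ->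
  measurable_fun setT (fun w => \big[Num.max/0]_(i | P i) f i w).
Proof.
move=> mf; rewrite unlock /=; elim: (index_enum I) => //= i s IH.
by case: (P i) => //; exact: measurable_maxr.
Qed.

Lemma measurable_fun_growth_factors n (M : T -> 'M[R]_n) :
  measurable_entries M ->
  measurable_fun setT (fun w => Num.max (rho_U (M w)) (rho_L (M w))).
Proof.
move=> mM; apply: measurable_maxr; apply: measurable_fun_bigmax => p;
  have [ul ur dl dr] := measurable_entries_blocks (measurable_entries_lead_split (p := p) mM);
  have q := measurable_entries_mulmx dl (measurable_entries_invmx ul).
  apply: measurable_funM; last first.
    by apply: (measurableT_comp (@measurable_fun_invr R)); exact: measurable_fun_spectral_norm.
  apply: measurable_fun_spectral_norm.
  by apply: measurable_entriesB => //; exact: measurable_entries_mulmx.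
exact: measurable_fun_spectral_norm.
Qed.

End measurable_entries_theory.

(** * Invariance of the joint law of the two orthogonal factors *)

Lemma continuous_mx (R : realType) (T : topologicalType) m n (f : T -> 'M[R]_(m, n)) :
  (forall i j, continuous (fun x => f x i j)) -> continuous f.
Proof.
move=> fc x A [P fP PA].
have : \forall y \near x, forall i j, P i j (f y i j).
  apply: filter_forall => i; apply: filter_forall => j; exact: fc.
by apply: filterS => y; exact: PA.
Qed.

(** Entries are continuous functions of a matrix, so each of their open rays has
    an open preimage. *)
Lemma measurable_entries_borel (R : realType) n :
  @measurable_entries _ (borel_mx R n) R n n (fun X => X).
Proof.
move=> i j; apply: measurable_fun_from_rays => c.
rewrite (_ : mkset _ = ~` [set X : 'M[R]_n | c < X i j]); last first.
  by apply/seteqP; split => X /=; rewrite leNgt => /negP.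
apply: measurableC; apply: sub_sigma_algebra.
have -> : [set X : 'M[R]_n | c < X i j] = (fun X : 'M[R]_n => X i j) @^-1` [set y | c < y].
  by [].
by apply: open_comp => [X _|]; [exact: coord_continuous|exact: open_gt].
Qed.

Lemma measurable_mulmxl (R : realType) n (Q : 'M[R]_n) :
  measurable_fun setT (fun X : borel_mx R n => (Q *m (X : 'M[R]_n) : borel_mx R n)).
Proof.
apply: (@measurability _ _ (borel_mx R n) (borel_mx R n) setT _ (@open 'M[R]_n)) =>
  [//|_ [B oB <-]].
rewrite setTI; apply: sub_sigma_algebra.
apply: (@open_comp 'M[R]_n 'M[R]_n (fun X => Q *m X)) => // X _; apply: continuous_mx => i j.
under eq_fun do rewrite mxE.
move=> Y; apply: (cvg_sumr (F := nbhs Y) (u := fun k (Z : 'M[R]_n) => Q i k * Z k j)) => k.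
by apply: cvgM; [exact: cvg_cst|exact: coord_continuous].
Qed.

Section haar_invariance.
Context (R : realType) (n : nat) (d : measure_display) (T : measurableType d)
  (P : probability T R) (U V : {mfun T >-> borel_mx R n}).

(** By independence both pairs have the law of a product measure, and left
    multiplication by Q does not change its first factor; a measure on a product
    that agrees with a product measure on rectangles is equal to it. *)
Lemma pair_law_mull_invariant (Q : 'M[R]_n)
    (S : set (borel_mx R n * borel_mx R n)%type) :
  is_haar_orthogonal (distribution P U) -> independent_rv P U V ->
  orthogonal_mx Q -> measurable S ->
  P [set w | S (Q *m (U w : 'M[R]_n), V w)] = P [set w | S (U w, V w)].
Proof.
move=> [_ haar] indep oQ mS.
have mU : measurable_fun setT U by [].
have mV : measurable_fun setT V by [].
have mQU : measurable_fun setT (fun w => Q *m (U w : 'M[R]_n) : borel_mx R n).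
  exact: (measurableT_comp (measurable_mulmxl Q)).
pose X := mfun_Sub (mem_set (measurable_fun_pair mU mV)).
pose Y := mfun_Sub (mem_set (measurable_fun_pair mQU mV)).
have lawX : (distribution P U \x distribution P V)%E S = distribution P X S.
  exact: product_measure_unique.
have lawY : (distribution P U \x distribution P V)%E S = distribution P Y S.
  apply: product_measure_unique => // A B mA mB.
  transitivity (P (U @^-1` ((fun Z : 'M[R]_n => Q *m Z) @^-1` A) `&` V @^-1` B)).
    by [].
  rewrite indep //; last first.
    by rewrite -[X in measurable X]setTI; exact: measurable_mulmxl.
  by congr (_ * _)%E; exact: (haar Q A oQ mA).1.
transitivity (distribution P Y S); first by [].
by rewrite -lawY lawX.
Qed.

End haar_invariance.

(** * Tail of a quotient of two adjacent minors *)

Lemma orthogonal_unitmx (R : realType) n (Q : 'M[R]_n) : orthogonal_mx Q -> Q \in unitmx.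
Proof. by move=> /mulmx1_unit []. Qed.

Lemma measurable_fun_minor d (T : measurableType d) (R : realType) n p
    (f g : 'I_p -> 'I_n) (M : T -> 'M[R]_n) :
  measurable_entries M -> measurable_fun setT (fun w => minor f g (M w)).
Proof. by move=> mM; apply: measurable_fun_det; exact: measurable_entries_mxsub. Qed.

(** Unit vectors with slopes j / N replace equally spaced angles: for j < N they
    lie within an eighth of a turn, and their separation is computed without
    trigonometry. *)
Definition slope_dir (R : realType) (N j : nat) : R * R :=
  let s := j%:R / N%:R in
  ((Num.sqrt (1 + s ^+ 2))^-1, s / Num.sqrt (1 + s ^+ 2)).

Lemma slope_dir_unit (R : realType) N j :
  (slope_dir R N j).1 ^+ 2 + (slope_dir R N j).2 ^+ 2 = 1.
Proof.
rewrite /slope_dir /=; move: (j%:R / N%:R) => s.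
have s1 : 0 < 1 + s ^+ 2 by rewrite ltr_pwDl ?sqr_ge0.
rewrite exprMn exprVn sqr_sqrtr ?ltW //.
by field; rewrite gt_eqF.
Qed.

(** The cross product of (1, s) and (1, s') is s' - s, at least 1 / N in absolute
    value, and the product of their lengths is at most 2. *)
Lemma slope_dir_sep (R : realType) N j k : (j < N)%N -> (k < N)%N -> j != k ->
  2 <= (4 * N%:R) *
    `|(slope_dir R N j).1 * (slope_dir R N k).2 - (slope_dir R N j).2 * (slope_dir R N k).1|.
Proof.
move=> jN kN jk; have N0 : 0 < N%:R :> R by rewrite ltr0n (leq_ltn_trans _ jN).
have slope i : (i < N)%N -> 0 <= i%:R / N%:R :> R /\ i%:R / N%:R <= 1 :> R.
  move=> iN; split; first by rewrite divr_ge0.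
  by rewrite ler_pdivrMr // mul1r ler_nat ltnW.
rewrite /slope_dir /=.
have [sj0 sj1] := slope _ jN; have [sk0 sk1] := slope _ kN.
have gap : 1 <= N%:R * `|k%:R / N%:R - j%:R / N%:R| :> R.
  rewrite -mulrBl normrM normfV (gtr0_norm N0) mulrC divfK ?gt_eqF //.
  have : (1%:R : R) <= `|k%:Z - j%:Z|%N%:R.
    by rewrite ler_nat absz_gt0 subr_eq0 eqz_nat eq_sym.
  by rewrite natr_absz intr_norm rmorphB.
set sj := j%:R / N%:R in sj0 sj1 gap *; set sk := k%:R / N%:R in sk0 sk1 gap *.
have root (s : R) : 0 <= s -> s <= 1 -> 0 < Num.sqrt (1 + s ^+ 2) :> R
    /\ Num.sqrt (1 + s ^+ 2) ^+ 2 <= 2 :> R.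
  move=> s0 s1; have : 0 < 1 + s ^+ 2 by rewrite ltr_pwDl ?sqr_ge0.
  rewrite sqrtr_gt0 => h; split => //; rewrite sqr_sqrtr ?(ltW h) //.
  by have := exprn_ile1 2 s0 s1; lra.
have [wj0 wj2] := root _ sj0 sj1; have [wk0 wk2] := root _ sk0 sk1.
set wj := Num.sqrt (1 + sj ^+ 2) in wj0 wj2 *; set wk := Num.sqrt _ in wk0 wk2 *.
have -> : wj^-1 * (sk / wk) - sj / wj * wk^-1 = (sk - sj) / (wj * wk).
  by field; rewrite !gt_eqF.
have ww0 : 0 < wj * wk by rewrite mulr_gt0.
rewrite normrM normfV (gtr0_norm ww0) mulrA ler_pdivlMr // -mulrA.
have ww : wj * wk <= 2.
  have := sqr_ge0 (wj - wk); rewrite sqrrB => h; lra.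
lra.
Qed.

Section tail.
Context (R : realType) (n : nat) (d : measure_display) (T : measurableType d)
  (P : probability T R) (U V : {mfun T >-> borel_mx R n}) (A : 'M[R]_n).
Context (haarU : is_haar_orthogonal (distribution P U)).
Context (indepUV : independent_rv P U V).

Let Abar (w : T) : 'M[R]_n := (U w : 'M[R]_n) *m A *m (V w : 'M[R]_n).

Lemma measurable_entries_Abar : measurable_entries Abar.
Proof.
apply: measurable_entries_mulmx; first apply: measurable_entries_mulmx.
- by move=> i j; apply: measurableT_comp (measurable_entries_borel i j) _.
- exact: measurable_entries_cst.
- by move=> i j; apply: measurableT_comp (measurable_entries_borel i j) _.
Qed.

Lemma measurable_minor_event p (f f' g : 'I_p -> 'I_n) (c : R) :
  measurable [set w | c * `|minor f g (Abar w)| < `|minor f' g (Abar w)|].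
Proof.
apply: measurable_set_ltr.
  apply: measurable_funM => //; apply: measurableT_comp => //.
  exact: measurable_fun_minor measurable_entries_Abar.
by apply: measurableT_comp => //; exact: measurable_fun_minor measurable_entries_Abar.
Qed.

(** The rotated copies of the event, one for each direction [slope_dir R N j],
    are disjoint and equally likely, so N times their common probability is at
    most 1.  Where both minors vanish the rotations have no effect; the
    strict inequality excludes these outcomes. *)
Lemma minor_ratio_tail p (f g : 'I_p -> 'I_n) (i0 : 'I_p) (k : 'I_n) (N : nat) :
  (0 < N)%N -> injective f -> (forall j, f j != k) ->
  (P [set w | (4 * N%:R) * `|minor f g (Abar w)| < `|minor (subst_row f i0 k) g (Abar w)| ]%R
    <= (N%:R^-1)%:E)%E.
Proof.
move=> N0 finj fk; set E := mkset _.
have Nr0 : 0 < N%:R :> R by rewrite ltr0n.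
pose G (j : nat) := rot_mx (f i0) k (slope_dir R N j).1 (slope_dir R N j).2.
have oG j : orthogonal_mx (G j) by apply: rot_mx_orthogonal (fk i0) (slope_dir_unit R N j).
pose S : set (borel_mx R n * borel_mx R n)%type := [set z |
  (4 * N%:R) * `|minor f g ((z.1 : 'M[R]_n) *m A *m (z.2 : 'M[R]_n))|
   < `|minor (subst_row f i0 k) g ((z.1 : 'M[R]_n) *m A *m (z.2 : 'M[R]_n))| ].
have mS : measurable S.
  have mM : measurable_entries (fun z : borel_mx R n * borel_mx R n =>
      (z.1 : 'M[R]_n) *m A *m (z.2 : 'M[R]_n)).
    apply: measurable_entries_mulmx; first apply: measurable_entries_mulmx.
    - by move=> i j; apply: measurableT_comp (measurable_entries_borel i j) _.
    - exact: measurable_entries_cst.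
    - by move=> i j; apply: measurableT_comp (measurable_entries_borel i j) _.
  apply: measurable_set_ltr.
    apply: measurable_funM => //; apply: measurableT_comp => //.
    exact: measurable_fun_minor mM.
  by apply: measurableT_comp => //; exact: measurable_fun_minor mM.
pose F (j : 'I_N) := [set w | S (G j *m (U w : 'M[R]_n), V w)].
have PF j : P (F j) = P E by exact: pair_law_mull_invariant.
have mF j : measurable (F j).
  have h : measurable_fun setT (fun w => (G j *m (U w : 'M[R]_n) : borel_mx R n, V w)).
    by apply: measurable_fun_pair => //; exact: (measurableT_comp (measurable_mulmxl (G j))).
  by have := h measurableT _ mS; rewrite setTI.
have tF : trivIset [set: 'I_N] F.
  apply/trivIsetP => /= j1 j2 _ _ j12; apply/seteqP; split => // w /= [].
  rewrite /F /S /= -!mulmxA !(minor_rot, minor_subst_row_rot) // => h1 h2.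
  have t0 : 0 < 4 * N%:R :> R by rewrite mulr_gt0.
  exact: rotated_cones_disjoint t0 (slope_dir_unit R N j1) (slope_dir_unit R N j2)
    (slope_dir_sep R (ltn_ord j1) (ltn_ord j2) j12) h1 h2.
have : (P (\big[setU/set0]_(j < N) F j) <= 1)%E.
  by apply: probability_le1; apply: bigsetU_measurable.
rewrite measure_bigsetU_ord // (eq_bigr (fun=> P E)) // => [|j _]; last exact: PF.
have mE : measurable E by exact: measurable_minor_event.
have : P E \is a fin_num by exact: fin_num_measure.
move/fineK => <-; rewrite sumEFin sumr_const card_ord !lee_fin -(mulr_natr (fine _)).
by rewrite -ler_pdivlMr // mul1r.
Qed.

Lemma measurable_pivot_event p (f f' g : 'I_p -> 'I_n) :
  measurable [set w | minor f g (Abar w) = 0 /\ minor f' g (Abar w) != 0].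
Proof.
rewrite (_ : mkset _ = ~` [set w | minor f g (Abar w) != 0]
       `&` [set w | minor f' g (Abar w) != 0]).
  by apply: measurableI; [apply: measurableC|]; apply: measurable_set_neq0;
     exact: measurable_fun_minor measurable_entries_Abar.
apply/seteqP; split => w /= [m0 m1]; split => //; first by rewrite m0 eqxx.
by apply/eqP/negPn/negP.
Qed.

(** The event lies in all the tail events of [minor_ratio_tail]. *)
Lemma minor_pivot_null p (f g : 'I_p -> 'I_n) (i0 : 'I_p) (k : 'I_n) :
  injective f -> (forall j, f j != k) ->
  P [set w | minor f g (Abar w) = 0 /\ minor (subst_row f i0 k) g (Abar w) != 0] = 0%E.
Proof.
move=> finj fk; set E := mkset _.
have mE : measurable E by exact: measurable_pivot_event.
apply/eqP; rewrite -measure_le0; apply/lee_addgt0Pr => e e0; rewrite add0e.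
have [N _ /(_ N (leqnn N)) hN] := near_infty_natSinv_lt (PosNum e0).
apply: (@le_trans _ _ (N.+1%:R^-1)%:E); last by rewrite lee_fin ltW.
apply: le_trans (minor_ratio_tail g i0 (ltn0Sn N) finj fk).
apply: le_measure; rewrite ?inE //; first exact: measurable_minor_event.
by move=> w /= [-> h]; rewrite normr0 mulr0 normr_gt0.
Qed.

End tail.

(** * Leading minors are almost surely nonzero *)

Lemma eq_minor (R : comNzRingType) n p (f f' g g' : 'I_p -> 'I_n) (M : 'M[R]_n) :
  f =1 f' -> g =1 g' -> minor f g M = minor f' g' M.
Proof.
by move=> ff' gg'; congr (\det _); apply/matrixP => a b; rewrite !mxE ff' gg'.
Qed.

Definition lead n p (j : 'I_p) : 'I_n.+1 := inord j.
Arguments lead n p j : clear implicits.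

Lemma val_lead n p (j : 'I_p) : (p <= n.+1)%N -> lead n p j = j :> nat.
Proof. by move=> pn; rewrite inordK // (leq_trans (ltn_ord j)). Qed.

Lemma lead_inj n p : (p <= n.+1)%N -> injective (lead n p).
Proof. by move=> pn i j /(congr1 val) /=; rewrite !val_lead // => /val_inj. Qed.

(** Gives the entries of A21 A11^-1 the form to which [minor_ratio_tail] applies. *)
Lemma lower_entry_minor (R : realType) n (p : 'I_n.+1) (A : 'M[R]_n.+1)
    (k : 'I_(n.+1 - p)) (i : 'I_p) :
  minor (lead n p) (lead n p) A != 0 ->
  (dlsubmx (lead_split p A) *m invmx (ulsubmx (lead_split p A))) k i
  = minor (subst_row (lead n p) i (inord (p + k))) (lead n p) A / minor (lead n p) (lead n p) A.
Proof.
have pn : (p <= n.+1)%N by exact: ltnW.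
have castl e (j : 'I_p) : cast_ord e (lshift (n.+1 - p) j) = lead n p j.
  by apply/val_inj; rewrite /= val_lead.
have castr (e : (p + (n.+1 - p))%N = n.+1) : cast_ord e (rshift p k) = inord (p + k).
  apply/val_inj; rewrite /= inordK //.
  by rewrite -ltn_subRL ltn_ord.
have ul : ulsubmx (lead_split p A) = mxsub (lead n p) (lead n p) A.
  by apply/matrixP => a b; rewrite !mxE castmxE /= !castl.
move=> m0; rewrite ul mul_invmx_cramer ?unitmxE ?unitfE //; congr (_ / _).
congr (\det _); apply/matrixP => a b; rewrite !mxE /subst_row castmxE /= castr castl.
by case: ifP.
Qed.

Section generic.
Context (R : realType) (n : nat) (d : measure_display) (T : measurableType d)
  (P : probability T R) (U V : {mfun T >-> borel_mx R n.+1}) (A : 'M[R]_n.+1).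
Context (Aunit : A \in unitmx).
Context (haarU : is_haar_orthogonal (distribution P U)).
Context (haarV : is_haar_orthogonal (distribution P V)).
Context (indepUV : independent_rv P U V).

Let Abar (w : T) : 'M[R]_n.+1 := (U w : 'M[R]_n.+1) *m A *m (V w : 'M[R]_n.+1).

Lemma ae_notin (E : set T) : measurable E -> P E = 0%E -> \forall w \ae P, ~ E w.
Proof. by move=> mE PE; exists E; split => // w /= /contrapT. Qed.

Lemma ae_orthogonal (W : {mfun T >-> borel_mx R n.+1}) :
  is_haar_orthogonal (distribution P W) ->
  \forall w \ae P, orthogonal_mx (W w : 'M[R]_n.+1).
Proof.
move=> [W1 _]; pose O : set (borel_mx R n.+1) := @orthogonal_mx R n.+1.
have mO : measurable (W @^-1` O).
  have mW : measurable_entries (fun w => W w : 'M[R]_n.+1).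
    by move=> i j; apply: measurableT_comp (measurable_entries_borel i j) _.
  have mWt : measurable_entries (fun w => (W w : 'M[R]_n.+1)^T).
    by move=> i j; under eq_fun do rewrite mxE; exact: mW.
  have mD : measurable_entries (fun w => (W w : 'M[R]_n.+1) *m (W w : 'M[R]_n.+1)^T - 1%:M).
    apply: measurable_entriesB; first exact: measurable_entries_mulmx.
    exact: measurable_entries_cst.
  rewrite (_ : _ @^-1` _ = ~` \bigcup_(z in [set: 'I_n.+1 * 'I_n.+1])
     [set w | ((W w : 'M[R]_n.+1) *m (W w : 'M[R]_n.+1)^T - 1%:M) z.1 z.2 != 0]).
    apply: measurableC; apply: fin_bigcup_measurable => // z _.
    exact: measurable_set_neq0.
  apply/seteqP; split => w /=.
    by rewrite /O /= /orthogonal_mx /= => WW [z _ /=]; rewrite WW subrr mxE eqxx.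
  move=> h; apply/eqP; rewrite -subr_eq0; apply/eqP/matrixP => i j; rewrite [RHS]mxE.
  by apply/eqP/contraT => hn; case: h; exists (i, j).
have := ae_notin (measurableC mO); rewrite /= => h.
have {}h : \forall w \ae P, ~ (~` (W @^-1` O)) w.
  by apply: h; rewrite probability_setC //= (_ : P _ = 1%E) // subee.
by apply: filterS h => w /contrapT.
Qed.

Lemma ae_Abar_unit : \forall w \ae P, Abar w \in unitmx.
Proof.
move: (ae_orthogonal haarU) (ae_orthogonal haarV); apply: filterS2 => w.
move=> /orthogonal_unitmx hU /orthogonal_unitmx hV.
by rewrite !unitmx_mul hU Aunit.
Qed.

(** If the leading minor of size p is nonzero, [minor_extend] provides a row k
    that completes the first p rows to a nonzero minor of size p + 1, and
    [minor_pivot_null] transfers this to the row following the first p. *)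
Lemma ae_lead_minor p : (p <= n.+1)%N ->
  \forall w \ae P, minor (lead n p) (lead n p) (Abar w) != 0.
Proof.
elim: p => [_|p IH pn].
  by apply: filterE => w; rewrite /minor det_mx00 oner_eq0.
pose f := lead n p.+1.
have finj : injective f by exact: lead_inj.
have pivot k : \forall w \ae P,
    ~ (minor f f (Abar w) = 0 /\ minor (subst_row f ord_max k) f (Abar w) != 0).
  (* For a row k already selected by f, the second minor is the first one or has
     a repeated row. *)
  have [fk|] := boolP [forall j, f j != k].
    apply: ae_notin; last exact: (minor_pivot_null A haarU indepUV f ord_max finj (forallP fk)).
    exact: measurable_pivot_event.
  rewrite negb_forall => /existsP[j /negPn/eqP fj]; apply: filterE => w [f0 /negP]; apply.
  have [jm|jm] := eqVneq j ord_max.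
    rewrite -(@eq_minor _ _ _ f _ f) ?f0 // => a; rewrite /subst_row -fj.
    by case: eqP => // ->; rewrite jm.
  apply/eqP; apply: (determinant_alternate jm) => b.
  by rewrite !mxE /subst_row eqxx (negbTE jm) fj.
have pivots : \forall w \ae P, forall k,
    ~ (minor f f (Abar w) = 0 /\ minor (subst_row f ord_max k) f (Abar w) != 0).
  exact: filter_forall.
move: pivots ae_Abar_unit (IH (ltnW pn)); apply: filterS3 => w piv Au m0.
have [|k mk] := @minor_extend _ _ _ (Abar w) f f Au finj.
  rewrite (@eq_minor _ _ _ _ (lead n p) _ (lead n p)) // => j;
    by rewrite /f /lead /= /bump leqNgt ltn_ord.
by apply/eqP => f0; case: (piv k).
Qed.

Lemma ae_all_lead_minors :
  \forall w \ae P, forall p : 'I_n.+1, minor (lead n p) (lead n p) (Abar w) != 0.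
Proof. by apply: filter_forall => p; apply: ae_lead_minor; exact: ltnW. Qed.

End generic.

(** * From dyadic tails to expectations *)

Lemma measurable_exists d (T : measurableType d) (I : finType) (F : I -> set T) :
  (forall i, measurable (F i)) -> measurable [set w | exists i, F i w].
Proof.
move=> mF; rewrite (_ : mkset _ = \bigcup_(i in [set: I]) F i).
  by apply: fin_bigcup_measurable.
by apply/seteqP; split => w /= [i]; [exists i|move=> _; exists i].
Qed.

Lemma union_bound d (T : measurableType d) (R : realType) (P : probability T R)
    (I : finType) (F : I -> set T) (m : nat) (c : R) :
  0 <= c -> (#|I| <= m)%N ->
  (forall i, measurable (F i)) -> (forall i, P (F i) <= c%:E)%E ->
  (P [set w | exists i, F i w] <= (m%:R * c)%:E)%E.
Proof.
move=> c0 Im mF PF; apply: (@le_trans _ _ (#|I|%:R * c)%:E); last first.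
  by rewrite lee_fin ler_wpM2r // ler_nat.
have -> : [set w | exists i, F i w] = [set w | exists2 i, i \in enum I & F i w].
  by apply/seteqP; split => w /= [i]; [exists i; rewrite ?mem_enum|move=> _; exists i].
rewrite cardE.
suff h : forall s : seq I, measurable [set w | exists2 i, i \in s & F i w] /\
  (P [set w | exists2 i, i \in s & F i w] <= ((size s)%:R * c)%:E)%E.
  exact: (h (enum I)).2.
elim => [|i s [ms IH]].
  rewrite (_ : mkset _ = set0); first by rewrite measure0 mul0r.
  by apply/seteqP; split => w //= [].
have -> : [set w | exists2 j, j \in i :: s & F j w] =
    F i `|` [set w | exists2 j, j \in s & F j w].
  apply/seteqP; split => w /=.
    by case=> j; rewrite inE => /predU1P[-> |js] Fj; [left|right; exists j].
  by case=> [Fi|[j js Fj]]; [exists i; rewrite ?mem_head|exists j; rewrite ?inE ?js ?orbT].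
split; first exact: measurableU.
apply: (le_trans (measureU2 _ (mF i) ms)).
by rewrite /= -natr1 mulrDl mul1r addrC EFinD; apply: leeD.
Qed.

Section log_tail.
Context (R : realType) (d : measure_display) (T : measurableType d)
  (P : probability T R).

(** A random variable that exceeds a + k b only on the k-th event exceeds a by at
    most b times the number of events that occur, see [le_count_events]. *)
Definition count_events (F : nat -> set T) (w : T) : \bar R :=
  (\sum_(0 <= k <oo) (\1_(F k) w)%:E)%E.

Lemma count_events_ge0 F w : (0 <= count_events F w)%E.
Proof. by apply: nneseries_ge0 => k _ _; rewrite lee_fin. Qed.

Lemma measurable_count_events F :
  (forall k, measurable (F k)) -> measurable_fun setT (count_events F).
Proof.
move=> mF; apply: (ge0_emeasurable_sum (P := xpredT)) => [k w _ _|k _]; first by rewrite lee_fin.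
by apply/measurable_EFinP.
Qed.

(** Either some event fails, and the first one to fail, of index K, bounds x
    while the K previous ones are counted; or all events occur, and then any K
    large enough will do. *)
Lemma le_count_events (F : nat -> set T) w (x a b : R) : 0 < b ->
  (forall k, ~ F k w -> x <= a + k%:R * b) ->
  (x%:E <= a%:E + b%:E * count_events F w)%E.
Proof.
move=> b0 xF.
have [K FK xK] : exists2 K : nat, (forall k, (k < K)%N -> F k w) & x <= a + K%:R * b.
  have [[k0 Fk0]|allF] := pselect (exists k, ~ F k w).
    have ex : exists k, `[< ~ F k w >] by exists k0; apply/asboolP.
    case: (ex_minnP ex) => k /asboolP Fk kmin; exists k; last exact: xF.
    move=> j jk; apply: contrapT => Fj; have := kmin j; rewrite leqNgt jk.
    by move=> /(_ (asboolT Fj)).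
  exists (Num.truncn ((x - a) / b)).+1 => [k _|].
    by apply: contrapT => Fk; apply: allF; exists k.
  by rewrite -lerBlDl -ler_pdivrMr // ltW // truncnS_gt.
apply: (@le_trans _ _ (a%:E + b%:E * K%:R%:E)%E).
  by rewrite -EFinM -EFinD lee_fin [b * _]mulrC.
rewrite leeD2l // lee_pmul2l ?lte_fin //.
apply: (@le_trans _ _ (\sum_(0 <= k < K) (\1_(F k) w)%:E)%E); last first.
  by apply: nneseries_lim_ge => k _ _; rewrite lee_fin.
rewrite sumEFin lee_fin (eq_big_nat _ _ (F2 := fun=> 1)) => [|k /andP[_ kK]].
  by rewrite sumr_const_nat subn0.
by rewrite indicE mem_set //; exact: FK.
Qed.

Lemma expected_count_events F :
  (forall k, measurable (F k)) -> (forall k, P (F k) <= ((2 ^ k)%:R^-1)%:E)%E ->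
  (\int[P]_w count_events F w <= 2%:E)%E.
Proof.
move=> mF PF; rewrite integral_nneseries //; last by move=> k; apply/measurable_EFinP.
have e := @cvg_geometric_eseries_half R 2 0.
rewrite expr0 divr1 in e; rewrite -(cvg_lim _ e) //.
apply: lee_nneseries => [k _ _|k _].
  by apply: integral_ge0 => w _; rewrite lee_fin.
rewrite integral_indic // setIT; apply: le_trans (PF k) _.
by rewrite lee_fin addn1 expnS natrM invfM mulrA divff // mul1r.
Qed.

Lemma integral_affine_count_le F (a b : R) : 0 <= a -> 0 <= b ->
  (forall k, measurable (F k)) -> (forall k, P (F k) <= ((2 ^ k)%:R^-1)%:E)%E ->
  (\int[P]_w (a%:E + b%:E * count_events F w) <= (a + 2 * b)%:E)%E.
Proof.
move=> a0 b0 mF PF; have mS := measurable_count_events mF.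
rewrite ge0_integralD //; last 2 first.
- by move=> w _; rewrite mule_ge0 ?lee_fin // count_events_ge0.
- exact: emeasurable_funM.
have -> : (\int[P]__ a%:E = a%:E)%E.
  rewrite integral_cst // -[RHS]mule1; congr (_ * _)%E; exact: probability_setT.
rewrite ge0_integralZl //; last first.
  by move=> w _; exact: count_events_ge0.
rewrite EFinD leeD2l // [2 * b]mulrC EFinM lee_wpmul2l ?lee_fin //.
exact: expected_count_events.
Qed.

(** The positive part of X is dominated by a + b times the number of events of F
    that occur, the negative part similarly with H; each number has
    expectation at most the sum of the powers of 1 / 2, that is 2. *)
Lemma integrable_log_tail (X : T -> R) (F H : nat -> set T) (a a' b : R) :
  0 <= a -> 0 <= a' -> 0 < b ->
  measurable_fun setT X ->
  (forall k, measurable (F k)) -> (forall k, P (F k) <= ((2 ^ k)%:R^-1)%:E)%E ->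
  (forall k, measurable (H k)) -> (forall k, P (H k) <= ((2 ^ k)%:R^-1)%:E)%E ->
  (\forall w \ae P, forall k, ~ F k w -> X w <= a + k%:R * b) ->
  (\forall w \ae P, forall k, ~ H k w -> - X w <= a' + k%:R * b) ->
  P.-integrable setT (EFin \o X) /\ ('E_P[X] <= (a + 2 * b)%:E)%E.
Proof.
move=> a0 a'0 b0 mX mF PF mH PH XF XH.
have mEX : measurable_fun setT (EFin \o X) by apply/measurable_EFinP.
pose g G (c : R) w : \bar R := (c%:E + b%:E * count_events G w)%E.
have g0 G c w : 0 <= c -> (0 <= g G c w)%E.
  by move=> c0; rewrite adde_ge0 ?lee_fin // mule_ge0 ?lee_fin ?count_events_ge0 // ltW.
have mg G c : (forall k, measurable (G k)) -> measurable_fun setT (g G c).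
  move=> mG; apply: emeasurable_funD => //; apply: emeasurable_funM => //.
  exact: measurable_count_events.
have pos : (\int[P]_w ((EFin \o X)^\+ w) <= (a + 2 * b)%:E)%E.
  apply: le_trans (integral_affine_count_le a0 (ltW b0) mF PF).
  apply: ae_ge0_le_integral => //.
  - exact: measurable_funepos.
  - by move=> w _; exact: g0.
  - exact: mg.
  apply: filterS XF => w h _; rewrite funeposE ge_max g0 // andbT.
  exact: le_count_events.
have neg : (\int[P]_w ((EFin \o X)^\- w) <= (a' + 2 * b)%:E)%E.
  apply: le_trans (integral_affine_count_le a'0 (ltW b0) mH PH).
  apply: ae_ge0_le_integral => //.
  - exact: measurable_funeneg.
  - by move=> w _; exact: g0.
  - exact: mg.
  apply: filterS XH => w h _; rewrite funenegE ge_max g0 // andbT.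
  exact: le_count_events.
split.
  apply/integrableP; split => //.
  under eq_integral do rewrite -/((abse \o (EFin \o X)) _) fune_abse.
  rewrite ge0_integralD //; last 2 first.
  - exact: measurable_funepos.
  - exact: measurable_funeneg.
  by apply: le_lt_trans (leeD pos neg) _; rewrite -EFinD ltry.
rewrite unlock integralE; apply: le_trans pos; apply: geeDl.
by rewrite leeNl oppe0 integral_ge0.
Qed.

End log_tail.

(** * The logarithm of the growth factors *)

Section growth.
Context (R : realType) (n : nat) (d : measure_display) (T : measurableType d)
  (P : probability T R) (U V : {mfun T >-> borel_mx R n.+1}) (A : 'M[R]_n.+1).
Context (Aunit : A \in unitmx).
Context (haarU : is_haar_orthogonal (distribution P U)).
Context (haarV : is_haar_orthogonal (distribution P V)).
Context (indepUV : independent_rv P U V).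
Context (n0 : (0 < n)%N).

Let Abar (w : T) : 'M[R]_n.+1 := (U w : 'M[R]_n.+1) *m A *m (V w : 'M[R]_n.+1).
Let pivot (p : nat) w := minor (lead n p) (lead n p) (Abar w).
Let swapped (p q : nat) (i : 'I_p) w :=
  minor (subst_row (lead n p) i (inord (p + q))) (lead n p) (Abar w).
Let growth w := Num.max (rho_U (Abar w)) (rho_L (Abar w)).

Definition large_entry (N : nat) : set T :=
  [set w | exists p : 'I_n.+1, exists i : 'I_p, exists q : 'I_(n.+1 - p),
     (4 * N%:R) * `|pivot p w| < `|swapped q i w|].

Lemma measurable_large_entry N : measurable (large_entry N).
Proof.
by do 3 (apply: measurable_exists => ?); exact: measurable_minor_event.
Qed.

(** A union bound over p, i and q, of which there are at most n.+1 each. *)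
Lemma large_entry_tail N : (0 < N)%N ->
  (P (large_entry N) <= (n.+1%:R * (n.+1%:R * (n.+1%:R * N%:R^-1)))%:E)%E.
Proof.
move=> N0; have NV0 : 0 <= N%:R^-1 :> R by rewrite invr_ge0.
apply: union_bound => [||p|p]; rewrite ?mulr_ge0 ?card_ord //.
  by do 2 (apply: measurable_exists => ?); exact: measurable_minor_event.
have pn : (p <= n.+1)%N by exact: ltnW.
apply: union_bound => [||i|i]; rewrite ?mulr_ge0 ?card_ord //.
  by apply: measurable_exists => ?; exact: measurable_minor_event.
apply: union_bound => [||q|q]; rewrite ?card_ord ?leq_subr //.
  exact: measurable_minor_event.
apply: minor_ratio_tail => //; first exact: lead_inj.
move=> j; apply/eqP => /(congr1 val) /=; rewrite val_lead // inordK.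
  by move=> e; have := ltn_ord j; rewrite e ltnNge leq_addr.
by rewrite -ltn_subRL ltn_ord.
Qed.

Lemma growth_le w N : (0 < N)%N -> (forall p : 'I_n.+1, pivot p w != 0) ->
  ~ large_entry N w -> growth w <= 2 * (1 + n.+1%:R ^+ 2 * (4 * N%:R)).
Proof.
move=> N0 piv small; apply: growth_factors_le; first by rewrite mulr_ge0.
move=> p _ q i; rewrite lower_entry_minor; last exact: piv.
rewrite normrM normfV ler_pdivrMr ?normr_gt0; last exact: piv.
by rewrite leNgt; apply/negP => h; apply: small; exists p, i, q.
Qed.

(** For p = 1 the block A21 has a row of index 0, because n > 0. *)
Let q0 : (0 < n.+1 - 1)%N. Proof. by rewrite subn1. Qed.

(** A single entry suffices from below: for p = 1 the first entry of A21 A11^-1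
    is the quotient of the two first entries of the first column of Abar. *)
Definition small_entry (N : nat) : set T :=
  [set w | (4 * N%:R) * `|swapped 0 (ord0 : 'I_1) w| < `|pivot 1 w|].

Lemma measurable_small_entry N : measurable (small_entry N).
Proof. exact: measurable_minor_event. Qed.

(** [minor_ratio_tail] with the two minors exchanged: it is applied to the row
    function that selects row 1, in which row 0 is then substituted. *)
Lemma small_entry_tail N : (0 < N)%N -> (P (small_entry N) <= (N%:R^-1)%:E)%E.
Proof.
move=> N0; pose f := subst_row (lead n 1) ord0 (inord (1 + 0)).
have ford (j : 'I_1) : f j = inord 1 by rewrite /f /subst_row (ord1 j) eqxx.
have := minor_ratio_tail A haarU indepUV (lead n 1) ord0 (k := inord 0) (f := f) N0.
rewrite (_ : mkset _ = small_entry N); last first.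
  apply/seteqP; split => w; rewrite /small_entry /pivot /=;
    by rewrite (@eq_minor _ _ _ (subst_row f ord0 (inord 0)) (lead n 1) _ (lead n 1)) // => j;
       rewrite (ord1 j) /subst_row eqxx.
apply.
  by move=> i j _; rewrite (ord1 i) (ord1 j).
by move=> j; rewrite ford; apply/eqP => /(congr1 val); rewrite /= !inordK.
Qed.

Lemma growth_ge w N : (0 < N)%N -> (forall p : 'I_n.+1, pivot p w != 0) ->
  ~ small_entry N w -> (4 * N%:R)^-1 <= growth w.
Proof.
move=> N0 piv /negP; rewrite -leNgt => h.
pose p1 : 'I_n.+1 := Ordinal (n0 : 1 < n.+1)%N.
apply: le_trans (@growth_factors_ge R _ (Abar w) p1 (Ordinal q0) ord0 isT).
have t0 : 0 < 4 * N%:R :> R by rewrite mulr_gt0 ?ltr0n.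
rewrite lower_entry_minor; last exact: (piv p1).
rewrite normrM normfV ler_pdivlMr ?normr_gt0; last exact: (piv p1).
by rewrite mulrC ler_pdivrMr // mulrC.
Qed.

(** With thresholds N = n.+1 ^ 3 * 2 ^ k the union bound gives 2 ^- k, and
    off that event the growth factors are at most n.+1 ^+ 9 * 2 ^ k.  The
    constant is 9 + 2: the excess over 9 log n.+1 has expectation at most
    2 log 2. *)
Lemma growth_log_tail :
  let X w := ln (growth w) in
  P.-integrable setT (EFin \o X) /\ ('E_P[X] <= (11 * ln n.+1%:R)%:E)%E.
Proof.
move=> X; have m2 : 2 <= n.+1%:R :> R by rewrite ler_nat.
have m0 : 0 < n.+1%:R :> R by rewrite ltr0n.
have ln2m : ln 2 <= ln n.+1%:R :> R by rewrite ler_ln ?posrE.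
have ln20 : 0 < ln 2 :> R by rewrite ln_gt0 // ltr1n.
have lnm0 : 0 <= ln n.+1%:R :> R by apply: le_trans ln2m; exact: ltW.
have ln_2X k : ln (2 ^ k)%:R = k%:R * ln 2 :> R.
  by rewrite natrX lnXn // mulr_natl.
have ln4 : ln 4 = 2 * ln 2 :> R.
  by rewrite -[4]/(2 * 2)%N%:R natrM lnM ?posrE // -mulr2n mulr_natl.
have ae := ae_all_lead_minors Aunit haarU haarV indepUV.
pose N k := (n.+1 ^ 3 * 2 ^ k)%N.
have N0 k : (0 < N k)%N by rewrite muln_gt0 !expn_gt0.
have tailF k : (P (large_entry (N k)) <= ((2 ^ k)%:R^-1)%:E)%E.
  apply: le_trans (large_entry_tail (N0 k)) _; rewrite lee_fin /N natrM natrX.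
  rewrite le_eqVlt; apply/orP; left; apply/eqP.
  by field; rewrite ?gt_eqF // ltr0n expn_gt0.
have tailH k : (P (small_entry (2 ^ k)) <= ((2 ^ k)%:R^-1)%:E)%E.
  by apply: small_entry_tail; rewrite expn_gt0.
have [] := @integrable_log_tail R d T P X (fun k => large_entry (N k))
   (fun k => small_entry (2 ^ k)) (9 * ln n.+1%:R) (2 * ln 2) (ln 2) _ _ ln20 _ _ tailF _ tailH _ _.
- by rewrite mulr_ge0.
- by rewrite mulr_ge0 // ltW.
- apply: (measurableT_comp (@measurable_ln R)).
  exact: measurable_fun_growth_factors (measurable_entries_Abar U V A).
- by move=> k; exact: measurable_large_entry.
- by move=> k; exact: measurable_small_entry.
- move: ae; apply: filterS => w piv k small.
  have [W0|W0] := leP (growth w) 0.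
    by rewrite /X ln0 // addr_ge0 ?mulr_ge0 // ltW.
  have := growth_le (N0 k) piv small => h.
  have : growth w <= n.+1%:R ^+ 9 * (2 ^ k)%:R.
    apply: le_trans h _; rewrite /N natrM natrX.
    have k1 : 1 <= (2 ^ k)%:R :> R by rewrite ler1n expn_gt0.
    set m := n.+1%:R in m2 m0 *; set K := (2 ^ k)%:R in k1 *.
    (* 2 + 8 m^5 K <= 16 m^5 K <= m^9 K, as m >= 2 and m^5 K >= 1. *)
    have m5 : 1 <= m ^+ 5 by rewrite exprn_ege1 // (le_trans _ m2) // ler1n.
    have m4 : 16 <= m ^+ 4.
      by rewrite (_ : 16 = 2 ^+ 4) ?ler_pXn2r ?nnegrE ?(ltW m0) // -natrX.
    have mK : 1 <= m ^+ 5 * K by rewrite -[leLHS]mulr1 ler_pM.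
    have := ler_wpM2r (le_trans ler01 mK) m4.
    have -> : m ^+ 4 * (m ^+ 5 * K) = m ^+ 9 * K by ring.
    have -> : 2 * (1 + m ^+ 2 * (4 * (m ^+ 3 * K))) = 2 + 8 * (m ^+ 5 * K) by ring.
    lra.
  have K0 : 0 < (2 ^ k)%:R :> R by rewrite ltr0n expn_gt0.
  rewrite -ler_ln ?posrE ?mulr_gt0 ?exprn_gt0 // lnM ?posrE ?exprn_gt0 //.
  by rewrite lnXn // ln_2X -[_ *+ 9]mulr_natl.
- move: ae; apply: filterS => w piv k small.
  have k0 : (0 < 2 ^ k)%N by rewrite expn_gt0.
  have := growth_ge k0 piv small.
  have K0 : 0 < (2 ^ k)%:R :> R by rewrite ltr0n.
  have t0 : 0 < 4 * (2 ^ k)%:R :> R by rewrite mulr_gt0.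
  move=> h; have W0 : 0 < growth w by apply: lt_le_trans h; rewrite invr_gt0.
  move: h; rewrite -ler_ln ?posrE ?invr_gt0 // lnV ?posrE // lnM ?posrE // ln_2X.
  by rewrite ln4 /X lerNl.
move=> iX EX; split => //; apply: le_trans EX _; rewrite lee_fin; lra.
Qed.

End growth.

Theorem corollary5p19 (R : realType) :
  exists2 C : R, 0 < C &
  forall (n : nat) (A : 'M[R]_n) (d : measure_display) (T : measurableType d)
    (P : probability T R) (U V : {mfun T >-> borel_mx R n}),
    (2 <= n)%N ->
    A \in unitmx ->
    is_haar_orthogonal (distribution P U) ->
    is_haar_orthogonal (distribution P V) ->
    independent_rv P U V ->
    let Abar (w : T) : 'M[R]_n := (U w : 'M[R]_n) *m A *m (V w : 'M[R]_n) in
    let X (w : T) : R := ln (Num.max (rho_U (Abar w)) (rho_L (Abar w))) in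
    P.-integrable [set: T] (EFin \o X) /\
    ('E_P[X] <= (C * ln n%:R)%:E)%E.
Proof.
exists 11 => // -[//|n] A d T P U V n2 Au hU hV indep Abar X.
exact: growth_log_tail.
Qed.
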